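(* Let $M$ be a complex manifold. Then the Kobayashi pseudodistance $k_M\colon M\times M\to[0,+\infty)$ is locally Lipschitz.
   Context: Complex manifolds are connected. A function on a manifold is locally Lipschitz if it is locally Lipschitz (with respect to the Euclidean distance) when read in local charts; here the manifold is $M\times M$. *)

(* Defs.v *)
From HB Require Import structures.
From mathcomp Require Import all_boot all_order all_algebra.
From mathcomp Require Import complex.
From mathcomp Require Import all_classical all_reals all_analysis.
Import Order.TTheory GRing.Theory Num.Theory.
Import numFieldNormedType.Exports.

Set Implicit Arguments.
Unset Strict Implicit.
Unset Printing Implicit Defensive.

Local Open Scope classical_set_scope.
Local Open Scope ring_scope.

(* The usual topology of the complex numbers, with R[i] as a normed module over
   itself. Hence 'rV[R[i]]_n is C^n, and [differentiable] between such spaces is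
   complex (Frechet) differentiability: a map is holomorphic on an open set iff
   it is [differentiable] at each of its points. *)
HB.instance Definition _ (R : realType) :=
  PseudoPointedMetric.copy R[i] R[i]^o.
HB.instance Definition _ (R : realType) := NormedModule.copy R[i] R[i]^o.

(* Both functions of a chart are total; [chart_map] is meaningful on [chart_dom]
   only, and [chart_inv] on [chart_cod] only. *)
Record chart (R : realType) (X : Type) (n : nat) := Chart {
  chart_dom : set X ;
  chart_map : X -> 'rV[R[i]]_n ;
  chart_inv : 'rV[R[i]]_n -> X }.

Definition chart_cod (R : realType) (X : Type) (n : nat) (c : chart R X n) :
  set 'rV[R[i]]_n := chart_map c @` chart_dom c.

Definition is_chart (R : realType) (X : topologicalType) (n : nat)
    (c : chart R X n) : Prop :=
  [/\ open (chart_dom c),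
      open (chart_cod c),
      (forall p, chart_dom c p -> chart_inv c (chart_map c p) = p),
      (forall p, chart_dom c p -> {for p, continuous (chart_map c)}) &
      (forall x, chart_cod c x -> {for x, continuous (chart_inv c)})].

Definition holomorphic_transition (R : realType) (X : topologicalType)
    (n : nat) (c d : chart R X n) : Prop :=
  forall x, chart_cod c x -> chart_dom d (chart_inv c x) ->
    differentiable (chart_map d \o chart_inv c) x.

Record complex_manifold (R : realType) (n : nat) := ComplexManifold {
  carrier :> topologicalType ;
  atlas : set (chart R carrier n) ;
  manifold_hausdorff : hausdorff_space carrier ;
  manifold_second_countable : @second_countable carrier ;
  manifold_connected : connected [set: carrier] ;
  atlas_chart : forall c, atlas c -> is_chart c ;
  atlas_cover : forall p, exists2 c, atlas c & chart_dom c p ;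
  atlas_holomorphic :
    forall c d, atlas c -> atlas d -> holomorphic_transition c d }.

Definition unit_disc (R : realType) : set R[i] :=
  [set z | Normc.normc z < 1].

(* Normalized to have Gaussian curvature -4; equal to artanh of t. *)
Definition poincare_dist (R : realType) (z w : R[i]) : R :=
  let t := Normc.normc ((z - w) / (1 - z * w^*%C)) in
  2^-1 * ln ((1 + t) / (1 - t)).

(* Holomorphic maps from the unit disc to M, represented by total functions
   whose values outside the disc are irrelevant. *)
Definition holomorphic_disc (R : realType) (n : nat) (M : complex_manifold R n)
    (phi : R[i] -> M) : Prop :=
  forall z, unit_disc z ->
    {for z, continuous phi} /\
    (forall c, atlas c -> chart_dom c (phi z) ->
       differentiable (chart_map c \o phi) z).

(* +oo when no holomorphic disc contains both points. *)
Definition lempert (R : realType) (n : nat) (M : complex_manifold R n)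
    (p q : M) : \bar R :=
  ereal_inf [set l | exists (phi : R[i] -> M) (z w : R[i]),
    [/\ holomorphic_disc phi, unit_disc z, unit_disc w, phi z = p & phi w = q]
    /\ l = (poincare_dist z w)%:E].

Definition kobayashi (R : realType) (n : nat) (M : complex_manifold R n)
    (p q : M) : \bar R :=
  ereal_inf [set l | exists (m : nat) (x : nat -> M),
    [/\ (0 < m)%N, x 0%N = p, x m = q &
        l = (\sum_(j < m) lempert (x j) (x j.+1))%E]].

Definition prod_chart (R : realType) (X Y : Type) (m n : nat)
    (c : chart R X m) (d : chart R Y n) : chart R (X * Y) (m + n) :=
  {| chart_dom := chart_dom c `*` chart_dom d ;
     chart_map := fun p => row_mx (chart_map c p.1) (chart_map d p.2) ;
     chart_inv := fun x => (chart_inv c (lsubmx x), chart_inv d (rsubmx x)) |}.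

Definition prod_atlas (R : realType) (X Y : Type) (m n : nat)
    (A : set (chart R X m)) (B : set (chart R Y n)) :
    set (chart R (X * Y) (m + n)) :=
  [set e | exists c d, [/\ A c, B d & e = prod_chart c d]].

(* The norm of 'rV[R[i]]_n in the library is the sup norm, hence this. *)
Definition euclidean_dist (R : realType) (n : nat) (x y : 'rV[R[i]]_n) : R :=
  Num.sqrt (\sum_(i < n) Normc.normc (x ord0 i - y ord0 i) ^+ 2).

Definition locally_lipschitz (R : realType) (X : topologicalType) (n : nat)
    (A : set (chart R X n)) (f : X -> R) : Prop :=
  forall c, A c -> forall x, chart_cod c x ->
    exists (L : R) (W : set 'rV[R[i]]_n),
      [/\ nbhs x W, W `<=` chart_cod c &
          forall y z, W y -> W z ->
            `|f (chart_inv c y) - f (chart_inv c z)|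
              <= L * euclidean_dist y z].

(* Main.v *)
Require Import Defs.
From mathcomp Require Import all_boot all_order all_algebra.
From mathcomp Require Import complex.
From mathcomp Require Import all_classical all_reals all_analysis.
From mathcomp Require Import ring lra.
Import Order.TTheory GRing.Theory Num.Theory.
Import numFieldNormedType.Exports.

(** Two points [chart_inv c y] and [chart_inv c z] close to a given point of a
    chart [c] lie on the image of a holomorphic disc, namely a disc of fixed
    radius [4 r] on the complex line through [y] and [z], centred at [y] and
    read in the chart. On it, [z] has parameter [t = |z - y| / (4 r)], at most
    [1 / 2], and the Poincare distance from [0] to [t] is at most [2 t]. As the
    Lempert function bounds the Kobayashi pseudodistance from above, the latter
    is at most [(2 r)^-1 * |z - y|] near the given point
    ([kobayashi_le_supnorm]).

    Everything else follows from this bound and the triangle inequality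
    ([kobayashi_triangle]). The points at finite pseudodistance from a given
    point form a set which is nonempty, open and closed, hence everything by
    connectedness ([kobayashi_lty]). And the triangle inequality through the
    points of coordinates [z] bounds the variation of [kobayashi p q] by the
    sum of the variations in [p] and in [q]. The local bound holds for ordered
    pairs in either order, so that the symmetry of the pseudodistance plays no
    role. The estimates are made in the sup norm, which the Euclidean distance
    dominates. *)

Set Implicit Arguments.
Unset Strict Implicit.
Unset Printing Implicit Defensive.

Local Open Scope classical_set_scope.
Local Open Scope ring_scope.

(** * The sup norm of complex row vectors, as a real number *)

Lemma normc_ge0 (R : realType) (z : R[i]) : 0 <= Normc.normc z.
Proof. by case: z => a b; exact: sqrtr_ge0. Qed.

Section supnorm.
Variable R : realType.

(** The library norm of a complex matrix is a complex number with zero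
    imaginary part; this is its real part. *)
Definition supnorm (m n : nat) (v : 'M[R[i]]_(m, n)) : R := complex.Re `|v|.

Lemma supnormE m n (v : 'M[R[i]]_(m, n)) : `|v| = (supnorm v)%:C%C.
Proof. by rewrite /supnorm RRe_real// normr_real. Qed.

Lemma supnorm_ge0 m n (v : 'M[R[i]]_(m, n)) : 0 <= supnorm v.
Proof. by rewrite -ler0c -supnormE. Qed.

Lemma supnormD m n (v w : 'M[R[i]]_(m, n)) :
  supnorm (v + w) <= supnorm v + supnorm w.
Proof. by rewrite -lecR rmorphD /= -!supnormE ler_normD. Qed.

Lemma supnormZ m n (a : R[i]) (v : 'M[R[i]]_(m, n)) :
  supnorm (a *: v) = Normc.normc a * supnorm v.
Proof.
have : (supnorm (a *: v))%:C%C = (Normc.normc a * supnorm v)%:C%C :> R[i].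
  by rewrite rmorphM /= -!supnormE normrZ.
by move=> /(@complexI R).
Qed.

Lemma supnorm0_eq0 m n (v : 'M[R[i]]_(m, n)) : supnorm v = 0 -> v = 0.
Proof. by move=> v0; apply: normr0_eq0; rewrite supnormE v0. Qed.

Lemma supnormB m n (v w : 'M[R[i]]_(m, n)) : supnorm (v - w) = supnorm (w - v).
Proof. by rewrite /supnorm distrC. Qed.

Lemma coord_le_supnorm m n (v : 'M[R[i]]_(m, n)) i j :
  Normc.normc (v i j) <= supnorm v.
Proof.
rewrite -lecR -supnormE.
rewrite (_ : `|v| = (\big[Num.max/0%:nng]_ij `|v ij.1 ij.2|%:nng)%:num)//.
rewrite (_ : (Normc.normc (v i j))%:C%C = `|v i j|%:nng%:num)// num_le.
exact: (@le_bigmax _ _ _ _ (fun ij => `|v ij.1 ij.2|%:nng) (i, j)).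
Qed.

Lemma supnorm_le m n (v : 'M[R[i]]_(m, n)) (a : R) : 0 <= a ->
  (forall i j, Normc.normc (v i j) <= a) -> supnorm v <= a.
Proof.
move=> a0 va; have [v0|v0] := eqVneq (mx_norm v) 0.
  by rewrite (_ : supnorm v = 0)//; exact: (congr1 (@complex.Re R) v0).
have [ij vij] := mx_norm_neq0 v0.
rewrite (_ : supnorm v = Normc.normc (v ij.1 ij.2))//.
apply: (@complexI R); rewrite -supnormE; exact: vij.
Qed.

Lemma supnorm_lsubmx n1 n2 (v : 'rV[R[i]]_(n1 + n2)) :
  supnorm (lsubmx v) <= supnorm v.
Proof.
by apply: supnorm_le => [|i j]; rewrite ?supnorm_ge0// mxE coord_le_supnorm.
Qed.

Lemma supnorm_rsubmx n1 n2 (v : 'rV[R[i]]_(n1 + n2)) :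
  supnorm (rsubmx v) <= supnorm v.
Proof.
by apply: supnorm_le => [|i j]; rewrite ?supnorm_ge0// mxE coord_le_supnorm.
Qed.

Lemma supnorm_le_euclidean n (y z : 'rV[R[i]]_n) :
  supnorm (y - z) <= euclidean_dist y z.
Proof.
apply: supnorm_le => [|i j]; first exact: sqrtr_ge0.
rewrite ord1 !mxE -[leLHS]ger0_norm ?normc_ge0// -sqrtr_sqr ler_wsqrtr//.
by rewrite (bigD1 j)//= lerDl sumr_ge0// => k _; exact: sqr_ge0.
Qed.

Lemma nbhs_supnorm n (x : 'rV[R[i]]_n) (A : set 'rV[R[i]]_n) :
  nbhs x A <->
  exists2 r : R, 0 < r & forall y, supnorm (x - y) < r -> A y.
Proof.
split=> [/nbhs_ballP[e /= e0 eA]|[r r0 rA]].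
  have eE : (complex.Re e)%:C%C = e by rewrite RRe_real// gtr0_real.
  exists (complex.Re e) => [|y xy]; first by rewrite -ltcR eE.
  by apply: eA; rewrite -ball_normE /= -eE supnormE ltcR.
apply/nbhs_ballP; exists r%:C%C => /= [|y]; first by rewrite ltcR.
by rewrite -ball_normE /= supnormE ltcR => /rA.
Qed.

End supnorm.

(** * The triangle inequality for the Kobayashi pseudodistance *)

(** No bound on the two points is needed: [ln] vanishes on nonpositive
    numbers. *)
Lemma poincare_dist_ge0 (R : realType) (z w : R[i]) : 0 <= poincare_dist z w.
Proof.
rewrite /poincare_dist; set t := Normc.normc _.
have t0 : 0 <= t by exact: normc_ge0.
rewrite mulr_ge0//; have [t1|t1] := ltP t 1.
  by rewrite ln_ge0// ler_pdivlMr ?subr_gt0// mul1r; lra.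
by rewrite ln0// mulr_ge0_le0 ?addr_ge0// invr_le0 subr_le0.
Qed.

Lemma poincare_dist0_le (R : realType) (t : R) : 0 <= t -> t <= 2^-1 ->
  poincare_dist 0 t%:C%C <= 2 * t.
Proof.
move=> t0 th; rewrite /poincare_dist mul0r subr0 divr1 sub0r.
have -> : Normc.normc (- t%:C%C) = t.
  by rewrite /= oppr0 expr0n addr0 sqrrN sqrtr_sqr ger0_norm.
have -> : (1 + t) / (1 - t) = 1 + 2 * t / (1 - t) by field; lra.
have t1 : 2 * t / (1 - t) <= 4 * t.
  by rewrite ler_pdivrMr; [nra|lra].
have t2 : 0 <= 2 * t / (1 - t) by rewrite divr_ge0; lra.
have : ln (1 + 2 * t / (1 - t)) <= 2 * t / (1 - t) by apply: le_ln1Dx; lra.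
lra.
Qed.

Section kobayashi.
Variables (R : realType) (n : nat) (M : complex_manifold R n).
Implicit Types p q : M.
Local Open Scope ereal_scope.

Lemma lempert_ge0 p q : 0 <= lempert p q.
Proof.
apply: le_ereal_inf_tmp => _ [phi [z [w [_ ->]]]].
by rewrite lee_fin poincare_dist_ge0.
Qed.

Lemma kobayashi_ge0 p q : 0 <= kobayashi p q.
Proof.
apply: le_ereal_inf_tmp => _ [m [x [_ _ _ ->]]].
by apply: sume_ge0 => j _; exact: lempert_ge0.
Qed.

Lemma kobayashi_le_lempert p q : kobayashi p q <= lempert p q.
Proof.
apply: ereal_inf_lbound; exists 1%N, (fun j => if j == 0%N then p else q).
by split=> //; rewrite big_ord1.
Qed.

(** Chains from [p] to [q] and from [q] to [r] concatenate. *)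
Lemma kobayashi_triangle p q r :
  kobayashi p r <= kobayashi p q + kobayashi q r.
Proof.
have [->|pqy] := eqVneq (kobayashi p q) +oo.
  by rewrite addye ?leey// gt_eqF// (lt_le_trans _ (kobayashi_ge0 _ _)).
have [->|qry] := eqVneq (kobayashi q r) +oo.
  by rewrite addey ?leey// gt_eqF// (lt_le_trans _ (kobayashi_ge0 _ _)).
have fpq : kobayashi p q \is a fin_num.
  by rewrite ge0_fin_numE ?ltey// kobayashi_ge0.
have fqr : kobayashi q r \is a fin_num.
  by rewrite ge0_fin_numE ?ltey// kobayashi_ge0.
apply/lee_addgt0Pr => e e0.
have e20 : (0 < e / 2)%R by rewrite divr_gt0.
have [_ [m1 [x [m10 x0 xm ->]] xlt]] := lb_ereal_inf_adherent e20 fpq.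
have [_ [m2 [y [m20 y0 ym ->]] ylt]] := lb_ereal_inf_adherent e20 fqr.
apply: (@le_trans _ _
  (\sum_(j < m1) lempert (x j) (x j.+1) +
   \sum_(j < m2) lempert (y j) (y j.+1))).
  apply: ereal_inf_lbound.
  pose u j := if (j < m1)%N then x j else y (j - m1)%N.
  exists (m1 + m2)%N, u; split.
  - by rewrite addn_gt0 m10.
  - by rewrite /u m10.
  - by rewrite /u ltnNge leq_addr/= addKn.
  rewrite big_split_ord/=; congr (_ + _); apply: eq_bigr => j _.
    rewrite /u ltn_ord; case: ltnP => // mj.
    have jm : j.+1 = m1 by apply/eqP; rewrite eqn_leq mj ltn_ord.
    by rewrite jm subnn xm y0.
  by rewrite /u ltnNge leq_addr/= addKn ltnNge -addnS leq_addr/= addKn.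
rewrite [e]splitr EFinD addeACA; apply: leeD; exact: ltW.
Qed.

End kobayashi.

(** * Holomorphic discs along complex lines in a chart *)

Lemma differentiable_line (R : realType) n (y v : 'rV[R[i]]_n) (z : R[i]) :
  differentiable (fun t : R[i] => y + t *: v) z.
Proof.
have h : differentiable (fun t : R[i] => t *: v) z.
  exact: (@differentiableZl _ _ _ (fun t : R[i] => t)).
exact: (differentiableD (differentiable_cst y z) h).
Qed.

Section charts.
Variables (R : realType) (n : nat) (M : complex_manifold R n).
Variables (c : chart R M n) (ac : atlas c).

Lemma holomorphic_disc_line (y v : 'rV[R[i]]_n) :
  (forall z, unit_disc z -> chart_cod c (y + z *: v)) ->
  holomorphic_disc (fun z : R[i] => chart_inv c (y + z *: v) : M).
Proof.
move=> yv z uz; split.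
  have [_ _ _ _ inv_continuous] := atlas_chart ac.
  apply: continuous_comp; last exact/inv_continuous/yv.
  exact/differentiable_continuous/differentiable_line.
move=> d ad dz.
apply: (@differentiable_comp _ _ _ _ (fun t : R[i] => y + t *: v)
  (chart_map d \o chart_inv c)); first exact: differentiable_line.
exact: (atlas_holomorphic ac ad (yv _ uz)).
Qed.

Lemma lempert_line_le (y v : 'rV[R[i]]_n) (t : R) :
  0 <= t -> t <= 2^-1 ->
  (forall z, unit_disc z -> chart_cod c (y + z *: v)) ->
  (lempert (chart_inv c y) (chart_inv c (y + t%:C%C *: v) : M)
    <= (2 * t)%:E)%E.
Proof.
move=> t0 th yv; apply: (@le_trans _ _ (poincare_dist 0 t%:C%C)%:E); last first.
  by rewrite lee_fin poincare_dist0_le.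
apply: ereal_inf_lbound.
exists (fun z : R[i] => chart_inv c (y + z *: v)), 0, t%:C%C; split=> //.
split.
- exact: holomorphic_disc_line.
- by rewrite /unit_disc /mkset Normc.normc0.
- by rewrite /unit_disc /= expr0n addr0 sqrtr_sqr ger0_norm//; lra.
- by rewrite scale0r addr0.
- by [].
Qed.

(** In chart coordinates, the pseudodistance of two nearby points is at most a
    constant times the distance of their coordinates. If the ball of radius
    [5 r] around [x] lies in the codomain of the chart, then for [y] and [z] in
    the ball of radius [r] the complex line through them contains a disc of
    centre [y] and radius [4 r] in the codomain, on which [z] has parameter
    [supnorm (z - y) / (4 r) <= 1 / 2]. *)
Lemma kobayashi_le_supnorm (x : 'rV[R[i]]_n) : chart_cod c x ->
  exists r L : R, [/\ 0 < r, 0 <= L,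
    (forall y, supnorm (x - y) < r -> chart_cod c y) &
    forall y z, supnorm (x - y) < r -> supnorm (x - z) < r ->
      (kobayashi (chart_inv c y) (chart_inv c z : M)
        <= (L * supnorm (z - y))%:E)%E].
Proof.
move=> cx; have [_ cod_open _ _ _] := atlas_chart ac.
have /nbhs_supnorm[s s0 scod] : nbhs x (chart_cod c).
  exact: open_nbhs_nbhs.
pose r := s / 5; have sE : s = 5 * r by rewrite /r; field.
have r0 : 0 < r by rewrite divr_gt0.
exists r, (2 * r)^-1; split=> //.
- by rewrite invr_ge0; lra.
- by move=> y xy; apply: scod; lra.
move=> y z xy xz; set d := supnorm (z - y).
have d0 : 0 <= d by exact: supnorm_ge0.
have d2 : d <= 2 * r.
  rewrite /d (_ : z - y = (z - x) + (x - y)); last by rewrite addrA subrK.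
  apply: (le_trans (supnormD _ _)).
  by rewrite (supnormB z x); lra.
apply: (le_trans (kobayashi_le_lempert _ _)).
(* if d = 0, then z = y and v = 0: the disc is constant *)
pose v := (4 * r / d)%:C%C *: (z - y).
have vE : supnorm v <= 4 * r.
  rewrite supnormZ /= expr0n addr0 sqrtr_sqr ger0_norm.
    rewrite -/d; have [->|dn0] := eqVneq d 0; first by rewrite mulr0; lra.
    by rewrite divfK.
  by rewrite divr_ge0//; lra.
have -> : z = y + (d / (4 * r))%:C%C *: v.
  rewrite /v scalerA -rmorphM /=; have [dE|dn0] := eqVneq d 0.
    rewrite (supnorm0_eq0 dE) scaler0 addr0.
    by apply/eqP; rewrite -subr_eq0 (supnorm0_eq0 dE).
  rewrite (_ : d / _ * _ = 1) ?scale1r ?subrKC//.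
  by field; rewrite dn0 /= gt_eqF.
have -> : (2 * r)^-1 * d = 2 * (d / (4 * r)) by field; rewrite gt_eqF.
apply: lempert_line_le.
- by rewrite divr_ge0//; lra.
- by rewrite ler_pdivrMr; lra.
move=> w; rewrite /unit_disc /= => w1; apply: scod.
rewrite opprD addrA; apply: (le_lt_trans (supnormD _ _)).
rewrite -scaleNr supnormZ normcN.
have : Normc.normc w * supnorm v <= 1 * (4 * r).
  by rewrite ler_pM ?normc_ge0 ?supnorm_ge0// ltW.
lra.
Qed.

End charts.

(** * Finiteness of the Kobayashi pseudodistance *)

Section finiteness.
Variables (R : realType) (n : nat) (M : complex_manifold R n).
Implicit Types p q : M.

Lemma kobayashi_near_lty p : exists2 U : set M, nbhs p U &
  forall q r, U q -> U r -> (kobayashi q r < +oo)%E.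
Proof.
have [c ac cp] := atlas_cover p.
have [dom_open _ invK map_continuous _] := atlas_chart ac.
have [r [L [r0 _ _ kL]]] : _ := kobayashi_le_supnorm ac (imageP _ cp).
exists (chart_dom c `&` [set q | supnorm (chart_map c p - chart_map c q) < r]).
  apply: filterI; first exact: open_nbhs_nbhs.
  have Br : nbhs (chart_map c p) [set y | supnorm (chart_map c p - y) < r].
    by apply/nbhs_supnorm; exists r.
  exact: (map_continuous _ cp _ Br).
move=> q1 q2 [cq1 q1r] [cq2 q2r].
rewrite -(invK _ cq1) -(invK _ cq2).
exact: le_lt_trans (kL _ _ q1r q2r) (ltry _).
Qed.

Lemma kobayashi_lty p q : (kobayashi p q < +oo)%E.
Proof.
pose A := [set r : M | (kobayashi p r < +oo)%E].
have step r1 r2 : A r1 -> (kobayashi r1 r2 < +oo)%E -> A r2.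
  move=> Ar1 r12; apply: le_lt_trans (kobayashi_triangle _ r1 _) _.
  exact: lte_add_pinfty.
suff AT : A = [set: M] by have : A q by rewrite AT.
apply: (@manifold_connected R n M).
- exists p; have [U Up UU] := kobayashi_near_lty p.
  by apply: UU; exact: nbhs_singleton.
- exists A; last by rewrite setTI.
  rewrite openE => r Ar; have [U Ur UU] := kobayashi_near_lty r.
  apply: filterS (Ur) => s Us; apply: (step r) => //.
  by apply: UU => //; exact: nbhs_singleton.
- exists A; last by rewrite setTI.
  move=> r clr; have [U Ur UU] := kobayashi_near_lty r.
  have [s [As Us]] := clr _ Ur.
  apply: (step s) => //.
  by apply: UU => //; exact: nbhs_singleton.
Qed.

Lemma kobayashi_fin_num p q : kobayashi p q \is a fin_num.
Proof. by rewrite ge0_fin_numE ?kobayashi_ge0 ?kobayashi_lty. Qed.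

Lemma fine_kobayashi_triangle p q r :
  fine (kobayashi p r) <= fine (kobayashi p q) + fine (kobayashi q r).
Proof.
rewrite -lee_fin EFinD !fineK ?kobayashi_fin_num//.
exact: kobayashi_triangle.
Qed.

End finiteness.

(** * Local Lipschitz continuity *)

Theorem proposition2p2 (R : realType) (n : nat) (M : complex_manifold R n) :
  (forall p q : M, (0 <= kobayashi p q < +oo)%E) /\
  locally_lipschitz (prod_atlas (@atlas R n M) (@atlas R n M))
    (fun pq : (M * M)%type => fine (kobayashi pq.1 pq.2)).
Proof.
split=> [p q|]; first by rewrite kobayashi_ge0 kobayashi_lty.
move=> _ [c [d [ac ad ->]]] _ [[p q] [/= cp dq] <-].
have [r1 [L1 [r10 L10 cod1 kL1]]] := kobayashi_le_supnorm ac (imageP _ cp).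
have [r2 [L2 [r20 L20 cod2 kL2]]] := kobayashi_le_supnorm ad (imageP _ dq).
pose x := row_mx (chart_map c p) (chart_map d q); rewrite -/x.
have near_cd y : supnorm (x - y) < Num.min r1 r2 ->
    supnorm (chart_map c p - lsubmx y) < r1 /\
    supnorm (chart_map d q - rsubmx y) < r2.
  rewrite lt_min => /andP[xy1 xy2]; split.
    apply: le_lt_trans xy1; apply: le_trans (supnorm_lsubmx _).
    by rewrite raddfB/= row_mxKl.
  apply: le_lt_trans xy2; apply: le_trans (supnorm_rsubmx _).
  by rewrite raddfB/= row_mxKr.
exists (L1 + L2), [set y | supnorm (x - y) < Num.min r1 r2]; split.
- by apply/nbhs_supnorm; exists (Num.min r1 r2); rewrite // lt_min r10.
- move=> y /near_cd[/cod1[p' cp' py] /cod2[q' dq' qy]].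
  by exists (p', q') => //=; rewrite py qy hsubmxK.
(* k (y1, y2) <= k (y1, z1) + k (z1, z2) + k (z2, y2), in chart coordinates *)
have upper y z : supnorm (x - y) < Num.min r1 r2 ->
    supnorm (x - z) < Num.min r1 r2 ->
    fine (kobayashi (chart_inv c (lsubmx y)) (chart_inv d (rsubmx y))) <=
    fine (kobayashi (chart_inv c (lsubmx z)) (chart_inv d (rsubmx z))) +
    (L1 + L2) * euclidean_dist y z.
  move=> /near_cd[y1 y2] /near_cd[z1 z2].
  have := fine_kobayashi_triangle (chart_inv c (lsubmx y))
    (chart_inv c (lsubmx z)) (chart_inv d (rsubmx y)).
  have := fine_kobayashi_triangle (chart_inv c (lsubmx z))
    (chart_inv d (rsubmx z)) (chart_inv d (rsubmx y)).
  have := kL1 _ _ y1 z1; have := kL2 _ _ z2 y2.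
  rewrite -[X in (X <= _)%E -> _]fineK ?kobayashi_fin_num// lee_fin => k2.
  rewrite -[X in (X <= _)%E -> _]fineK ?kobayashi_fin_num// lee_fin => k1.
  have l1 : L1 * supnorm (lsubmx z - lsubmx y) <= L1 * euclidean_dist y z.
    rewrite ler_wpM2l// -raddfB/= (le_trans (supnorm_lsubmx _))//.
    by rewrite supnormB supnorm_le_euclidean.
  have l2 : L2 * supnorm (rsubmx y - rsubmx z) <= L2 * euclidean_dist y z.
    rewrite ler_wpM2l// -raddfB/= (le_trans (supnorm_rsubmx _))//.
    exact: supnorm_le_euclidean.
  lra.
move=> y z Wy Wz /=; rewrite ler_distl.
have eC : euclidean_dist y z = euclidean_dist z y.
  congr Num.sqrt; apply: eq_bigr => k _.
  by rewrite -normcN opprB.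
have := upper _ _ Wy Wz; have := upper _ _ Wz Wy; rewrite -eC => h1 h2.
by apply/andP; split; lra.
Qed.
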